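(* The generating function $Q(x,y)\equiv Q(x,y;t)$ of quadrant walks with steps in $\mathcal S=\{(1,0),(-1,0),(0,-1),(-2,1)\}$ is the non-negative part (in $x$ and $y$) of the rational series $$R(x,y)=\frac{(x^2+1)(x+y)(y-x)(x^2y-2x-y)(x^3-x-2y)}{x^7y^3\left(1-t(x+\bar x+\bar x^2y+\bar y)\right)},$$ seen as a power series in $t$ with coefficients in $\mathbb Q[x,\bar x,y,\bar y]$.
   Context: $\bar x=1/x$, $\bar y=1/y$, $\mathbb N=\{0,1,2,\ldots\}$. $Q(x,y;t)=\sum_{i,j,n\ge0}q(i,j;n)x^iy^jt^n$, where $q(i,j;n)$ is the number of $n$-step walks with steps in $\mathcal S$ that start at $(0,0)$, end at $(i,j)$ and stay in $\mathbb N^2$. The non-negative part in $x$ and $y$ of a power series in $t$ with coefficients in $\mathbb Q[x,\bar x,y,\bar y]$ is obtained by keeping only the monomials $x^iy^jt^n$ with $i\ge0$ and $j\ge0$. *)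

(* Defs.v *)
From HB Require Import structures.
From mathcomp Require Import all_boot all_order all_algebra.
From mathcomp Require Import finmap monalg.
From mathcomp Require Import boolp.

Set Implicit Arguments.
Unset Strict Implicit.
Unset Printing Implicit Defensive.

Import GRing.Theory.
Local Open Scope fset_scope.
Local Open Scope ring_scope.

(* The coefficient of x^i y^j in p is p@_(i, j).  The ring structure that
   monalg puts on {malg R[K]} does not apply: it requires a monoid K without
   nontrivial units.  Hence the convolution product below. *)
Definition laurent : Type := {malg rat[(int * int)%type]}.

HB.instance Definition _ := GRing.Lmodule.on laurent.

Definition monomial (k : int * int) : laurent := << (1 : rat) *g k >>.

Section LaurentRing.
Implicit Types (f g h : laurent) (k l : int * int).

Definition lmul f g : laurent :=
  \sum_(k <- msupp f) \sum_(l <- msupp g) << f@_k * g@_l *g (k + l) >>.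

Lemma lmulw (d1 d2 : {fset int * int}) f g :
  msupp f `<=` d1 -> msupp g `<=` d2 ->
  lmul f g = \sum_(k <- d1) \sum_(l <- d2) << f@_k * g@_l *g (k + l) >>.
Proof.
move=> le_d1 le_d2; rewrite /lmul (big_fset_incl _ le_d1) /=.
  apply/eq_bigr=> k1 _; apply/big_fset_incl => // k _ /mcoeff_outdom ->.
  by rewrite mulr0 monalgU0.
move=> k _ /mcoeff_outdom g1k.
by rewrite big1 => // k' _; rewrite g1k mul0r monalgU0.
Qed.

Lemma lmulC : commutative lmul.
Proof.
move=> f g; rewrite /lmul exchange_big; apply: eq_bigr => l _.
by apply: eq_bigr => k _; rewrite mulrC [k + l]addrC.
Qed.

Lemma lmulDl : left_distributive lmul +%R.
Proof.
move=> f g h.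
rewrite (lmulw (fsubsetUl (msupp f) (msupp g)) (fsubset_refl (msupp h))).
rewrite (lmulw (fsubsetUr (msupp f) (msupp g)) (fsubset_refl (msupp h))).
rewrite (lmulw (msuppD_le f g) (fsubset_refl (msupp h))).
rewrite -big_split /=; apply/eq_bigr=> k1 _.
rewrite -big_split /=; apply/eq_bigr=> k2 _.
by rewrite mcoeffD mulrDl monalgUD.
Qed.

Lemma lmulDr : right_distributive lmul +%R.
Proof. by move=> f g h; rewrite lmulC lmulDl !(lmulC _ f). Qed.

Lemma lmul0 : left_zero 0 lmul.
Proof. by move=> g; rewrite /lmul msupp0 big_seq_fset0. Qed.

Lemma lmulr0 : right_zero 0 lmul.
Proof. by move=> g; rewrite lmulC lmul0. Qed.

Lemma lmulUU (a b : rat) k l :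
  lmul << a *g k >> << b *g l >> = << a * b *g (k + l) >>.
Proof. by rewrite (lmulw msuppU_le msuppU_le) !big_seq_fset1 !mcoeffUU. Qed.

Lemma lmul_sumE (f : laurent) : f = \sum_(k <- msupp f) << f@_k *g k >>.
Proof. exact: monalgE. Qed.

Lemma lmul1 : left_id (monomial 0) lmul.
Proof.
move=> g; rewrite (lmulw msuppU_le (fsubset_refl (msupp g))) big_seq_fset1.
rewrite [RHS]lmul_sumE; apply: eq_bigr => k _.
by rewrite mcoeffUU mul1r add0r.
Qed.

Lemma lmulA : associative lmul.
Proof.
move=> f g h; rewrite [f]lmul_sumE [g]lmul_sumE [h]lmul_sumE.
have [mul mulE] : exists mul, mul = lmul by exists lmul.
have S1 (I : Type) (r : seq I) (F : I -> laurent) u :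
  mul (\sum_(i <- r) F i) u = \sum_(i <- r) mul (F i) u.
  rewrite mulE; apply: (big_morph (lmul^~ u)) => [? ?|];
  by rewrite ?lmulDl ?lmul0.
have S2 (I : Type) (r : seq I) (F : I -> laurent) u :
  mul u (\sum_(i <- r) F i) = \sum_(i <- r) mul u (F i).
  rewrite mulE; apply: (big_morph (lmul u)) => [? ?|];
  by rewrite ?lmulDr ?lmulr0.
rewrite -mulE !S1; apply: eq_bigr => k _; rewrite S2 [in RHS](S2 _ (msupp g)) S1.
apply: eq_bigr => l _; rewrite !S2; apply: eq_bigr => m _.
by rewrite mulE !lmulUU mulrA addrA.
Qed.

Lemma lone_neq0 : monomial 0 != 0.
Proof. by rewrite monalgU_eq0 oner_eq0. Qed.

HB.instance Definition _ := GRing.Zmodule_isComNzRing.Build laurent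
  lmulA lmulC lmul1 lmulDl lone_neq0.

Lemma monomialD k l : monomial (k + l) = monomial k * monomial l.
Proof. by rewrite [RHS]lmulUU mulr1. Qed.

End LaurentRing.

(* fcoef f n is the coefficient of t^n. *)
Record fps (A : Type) := Fps { fcoef : nat -> A }.

HB.instance Definition _ (A : Type) := gen_eqMixin (fps A).
HB.instance Definition _ (A : Type) := gen_choiceMixin (fps A).

Section PowerSeries.
Variable A : comNzRingType.
Implicit Types (f g h : fps A).

Lemma fpsP f g : (forall n, fcoef f n = fcoef g n) <-> f = g.
Proof.
by split=> [|->//]; case: f g => [f] [g] /= /funext ->.
Qed.

Definition fps0 : fps A := Fps (fun=> 0).
Definition fps_opp f : fps A := Fps (fun n => - fcoef f n).
Definition fps_add f g : fps A := Fps (fun n => fcoef f n + fcoef g n).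

Lemma fps_addA : associative fps_add.
Proof. by move=> f g h; apply/fpsP => n /=; rewrite addrA. Qed.
Lemma fps_addC : commutative fps_add.
Proof. by move=> f g; apply/fpsP => n /=; rewrite addrC. Qed.
Lemma fps_add0 : left_id fps0 fps_add.
Proof. by move=> f; apply/fpsP => n /=; rewrite add0r. Qed.
Lemma fps_addN : left_inverse fps0 fps_opp fps_add.
Proof. by move=> f; apply/fpsP => n /=; rewrite addNr. Qed.

HB.instance Definition _ := GRing.isZmodule.Build (fps A)
  fps_addA fps_addC fps_add0 fps_addN.

Definition fpsC (a : A) : fps A := Fps (fun n => if n == 0%N then a else 0).
Definition fpsT : fps A := Fps (fun n => (n == 1%N)%:R).

Definition fps_mul f g : fps A :=
  Fps (fun n => \sum_(i < n.+1) fcoef f i * fcoef g (n - i)%N).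

Let trunc n f : {poly A} := \poly_(i < n.+1) fcoef f i.

Lemma fps_mul_trunc n m f g : (m <= n)%N ->
  fcoef (fps_mul f g) m = (trunc n f * trunc n g)`_m.
Proof.
move=> le_mn; rewrite coefM; apply: eq_bigr => i _; rewrite !coef_poly.
rewrite !ltnS (leq_trans (leq_ord i)) // (leq_trans (leq_subr _ _)) //.
Qed.

Lemma fps_mulC : commutative fps_mul.
Proof.
by move=> f g; apply/fpsP => n; rewrite !(fps_mul_trunc _ _ (leqnn n)) mulrC.
Qed.

Lemma fps_mulA : associative fps_mul.
Proof.
move=> f g h; apply/fpsP => n.
have -> : fcoef (fps_mul f (fps_mul g h)) n
          = (trunc n f * (trunc n g * trunc n h))`_n.
  rewrite coefM; apply: eq_bigr => i _; rewrite (@fps_mul_trunc n) ?leq_subr //.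
  by rewrite coef_poly ltn_ord.
have -> : fcoef (fps_mul (fps_mul f g) h) n
          = (trunc n f * trunc n g * trunc n h)`_n.
  rewrite coefM; apply: eq_bigr => i _; rewrite (@fps_mul_trunc n) ?leq_ord //.
  by rewrite coef_poly ltnS leq_subr.
by rewrite mulrA.
Qed.

Lemma fps_mul1 : left_id (fpsC 1) fps_mul.
Proof.
move=> f; apply/fpsP => n /=; rewrite big_ord_recl /= mul1r subn0.
by rewrite big1 ?addr0 // => i _; rewrite /bump /= mul0r.
Qed.

Lemma fps_mulDl : left_distributive fps_mul +%R.
Proof.
move=> f g h; apply/fpsP => n /=; rewrite -big_split /=.
by apply: eq_bigr => i _; rewrite mulrDl.
Qed.

Lemma fps1_neq0 : fpsC 1 != 0.
Proof. by apply/eqP => /fpsP/(_ 0%N) /= /eqP; rewrite oner_eq0. Qed.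

HB.instance Definition _ := GRing.Zmodule_isComNzRing.Build (fps A)
  fps_mulA fps_mulC fps_mul1 fps_mulDl fps1_neq0.

(* Inverses are picked classically; a non-unit is its own inverse, as in every
   unitRingType. *)
Definition fps_unit : pred (fps A) := fun f => `[< exists g, g * f = 1 >].

Definition fps_inv f : fps A :=
  if pselect (exists g, g * f = 1) is left e then projT1 (cid e) else f.

Lemma fps_mulVr : {in fps_unit, left_inverse 1 fps_inv *%R}.
Proof.
move=> f /asboolP uf; rewrite /fps_inv; case: pselect => // e.
by case: cid.
Qed.

Lemma fps_unitPl f g : g * f = 1 -> fps_unit f.
Proof. by move=> gf1; apply/asboolP; exists g. Qed.

Lemma fps_inv_out : {in [predC fps_unit], fps_inv =1 id}.
Proof.
by move=> f /asboolPn nuf; rewrite /fps_inv; case: pselect.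
Qed.

HB.instance Definition _ := GRing.ComNzRing_hasMulInverse.Build (fps A)
  fps_mulVr fps_unitPl fps_inv_out.

Lemma fcoefM f g n :
  fcoef (f * g) n = \sum_(i < n.+1) fcoef f i * fcoef g (n - i)%N.
Proof. by []. Qed.

Lemma fpsCM a b : fpsC (a * b) = fpsC a * fpsC b.
Proof.
apply/fpsP => n; rewrite fcoefM big_ord_recl /= subn0.
rewrite [X in _ + X]big1 ?addr0 => [|i _]; last by rewrite mul0r.
by case: (n == 0%N); rewrite ?mulr0.
Qed.

Lemma fcoefTM f n :
  fcoef (fpsT * f) n = if n is m.+1 then fcoef f m else 0.
Proof.
rewrite fcoefM; case: n => [|n]; first by rewrite big_ord1 mul0r.
rewrite big_ord_recl mul0r add0r big_ord_recl /= mul1r subSS subn0.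
by rewrite big1 ?addr0 // => i _; rewrite mul0r.
Qed.

Lemma fps_geometric a : (1 - fpsT * fpsC a) * Fps (fun n => a ^+ n) = 1.
Proof.
apply/fpsP => n; rewrite mulrBl mul1r -mulrA.
have -> : fpsC a * Fps (fun n => a ^+ n) = Fps (fun n => a ^+ n.+1).
  apply/fpsP => m; rewrite fcoefM big_ord_recl /= subn0 exprS.
  by rewrite big1 ?addr0 // => i _; rewrite mul0r.
change (a ^+ n - fcoef (fpsT * Fps (fun n => a ^+ n.+1)) n = fcoef 1 n).
by rewrite fcoefTM; case: n => [|n] /=; rewrite ?subr0 ?subrr.
Qed.

End PowerSeries.

Definition sX : fps laurent := fpsC (monomial (1, 0)).
Definition sY : fps laurent := fpsC (monomial (0, 1)).
Definition sT : fps laurent := fpsT laurent.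

Lemma fpsC_monomialV k l : k + l = 0 ->
  fpsC (monomial k) * fpsC (monomial l) = 1.
Proof. by move=> kl0; rewrite -fpsCM -monomialD kl0. Qed.

Lemma sX_unit : sX \is a GRing.unit.
Proof.
apply/unitrP; exists (fpsC (monomial (-1, 0))).
by split; apply: fpsC_monomialV.
Qed.

Lemma sY_unit : sY \is a GRing.unit.
Proof.
apply/unitrP; exists (fpsC (monomial (0, -1))).
by split; apply: fpsC_monomialV.
Qed.

Lemma sXV : sX^-1 = fpsC (monomial (-1, 0)).
Proof. by apply: (mulrI sX_unit); rewrite divrr ?sX_unit ?fpsC_monomialV. Qed.

Lemma sYV : sY^-1 = fpsC (monomial (0, -1)).
Proof. by apply: (mulrI sY_unit); rewrite divrr ?sY_unit ?fpsC_monomialV. Qed.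

Lemma geometric_unit (a : laurent) : 1 - sT * fpsC a \is a GRing.unit.
Proof.
apply/unitrP; exists (Fps (fun n => a ^+ n)).
by rewrite mulrC; split; apply: fps_geometric.
Qed.

Lemma fpsCD (a b : laurent) : fpsC (a + b) = fpsC a + fpsC b.
Proof. by apply/fpsP => -[|n] /=; rewrite ?addr0. Qed.

Lemma denominator_unit :
  sX ^+ 7 * sY ^+ 3 * (1 - sT * (sX + sX^-1 + sX ^- 2 * sY + sY^-1))
    \is a GRing.unit.
Proof.
have stepsE : sX + sX^-1 + sX ^- 2 * sY + sY^-1
    = fpsC (monomial (1, 0) + monomial (-1, 0)
            + monomial (-1, 0) * monomial (-1, 0) * monomial (0, 1)
            + monomial (0, -1)).
  by rewrite -exprVn sXV sYV expr2 !(fpsCD, fpsCM).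
rewrite stepsE unitrMl ?geometric_unit // unitrMl.
  by apply: unitrX; apply: sX_unit.
by apply: unitrX; apply: sY_unit.
Qed.

Definition in_quadrant (p : int * int) : bool := (0 <= p.1) && (0 <= p.2).

Definition laurent_nonneg (f : laurent) : laurent :=
  [malg p in msupp f => if in_quadrant p then f@_p else 0].

Definition nonneg_part (F : fps laurent) : fps laurent :=
  Fps (fun n => laurent_nonneg (fcoef F n)).

Lemma nonneg_partE F n p :
  (fcoef (nonneg_part F) n)@_p
  = if in_quadrant p then (fcoef F n)@_p else 0.
Proof.
rewrite mcoeffE; case: ifP => // /negbT /mcoeff_outdom ->.
by rewrite if_same.
Qed.

Section Walks.
Variable S : {fset int * int}.

Definition walk_pos n (w : n.-tuple S) (k : nat) : int * int :=
  \sum_(s <- take k w) val s.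

Definition walk_end n (w : n.-tuple S) : int * int := walk_pos w n.

Definition quadrant_walk n (w : n.-tuple S) : bool :=
  [forall k : 'I_n.+1, in_quadrant (walk_pos w k)].

Definition walk_count (p : int * int) (n : nat) : nat :=
  #|[set w : n.-tuple S | quadrant_walk w && (walk_end w == p)]|.

(* The domain [fset walk_end w | w : n.-tuple S] only serves to make the
   support visibly finite; see quadrant_seriesE. *)
Definition quadrant_series : fps laurent :=
  Fps (fun n => [malg p in [fset walk_end w | w : n.-tuple S] =>
                   (walk_count p n)%:R]).

Lemma quadrant_seriesE n p :
  (fcoef quadrant_series n)@_p = (walk_count p n)%:R.
Proof.
rewrite mcoeffE; case: ifP => // /negbT pP.
rewrite /walk_count (_ : [set w | _] = set0) ?cards0 //.
apply/setP => w; rewrite !inE; apply/negP => /andP[_ /eqP wp].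
by case/negP: pP; apply/imfsetP; exists w.
Qed.

Lemma walk_count_out p n : ~~ in_quadrant p -> walk_count p n = 0%N.
Proof.
move=> np; apply/eqP; rewrite cards_eq0; apply/eqP/setP => w; rewrite !inE.
apply/negP => /andP[/forallP/(_ ord_max) qw /eqP wp].
by move: np; rewrite -wp /walk_end qw.
Qed.

End Walks.

Definition steps : {fset int * int} :=
  [fset (1, 0); (-1, 0); (0, -1); (-2, 1)].

(* Main.v *)
Require Import Defs.
From HB Require Import structures.
From mathcomp Require Import finmap monalg ring zify.
From mathcomp Require Import all_boot all_order all_algebra.

Set Implicit Arguments.
Unset Strict Implicit.
Unset Printing Implicit Defensive.

Import GRing.Theory Num.Theory.
Local Open Scope ring_scope.

(** Write S for the step polynomial and P for the value of R at t = 0, so that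
    R is the sum of the t^n P S^n.  The coefficients r(p; n) of P S^n satisfy
    the recurrence r(p; n + 1) = sum_s r(p - s; n) of unconstrained walks.  The
    numbers of quadrant walks satisfy the same recurrence, except that the
    terms with p - s outside the quadrant are dropped.  No step has a
    coordinate larger than 1, so that these dropped points lie on one of the
    lines i = -1 and j = -1.  It therefore suffices that the quadrant part of P
    is 1 and that r vanishes on both lines, which is the content of
    [quadrant_series_nonneg_part].

    The vanishing is a residue computation.  The polynomial P is a multiple of
    both partial derivatives of S, and the cofactors are special.  With
    [u = x + 1/x + y/x^2] and [v = y/x^2 + 1/y],
      - P = S_x (-y u^2 + 2 u + 2 y + y^3) / y^3, and u = S - 1/y;
      - P = S_y (x^2 + 1) (x (x^2 - 1)^2 + 4 x - 2 x^2 (x^2 - 1) v) / x^5,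
        and v = S - x - 1/x.
    Hence P = S_x h(S) where the coefficients of h depend on y alone, and
    P S^n is the x-derivative of a Laurent polynomial: it has no coefficient
    on x^-1.  In the same way P S^n is a y-derivative and has no coefficient
    on y^-1.  The two factorizations are [exact_x] and [exact_y]; the vanishing
    they imply is [mcoeff_log_exact]. *)

(** * Coefficients of Laurent polynomials *)

Lemma laurent_ind (Q : laurent -> Prop) :
    Q 0 -> (forall f g, Q f -> Q g -> Q (f + g)) ->
    (forall (c : rat) k, Q << c *g k >>) ->
  forall f, Q f.
Proof.
move=> Q0 QD QU f; rewrite (lmul_sumE f).
by apply: big_ind => // k _; apply: QU.
Qed.

Lemma monomial_mulUU (c d : rat) k l :
  (<< c *g k >> : laurent) * << d *g l >> = << c * d *g (k + l) >>.
Proof. by rewrite [LHS]lmulUU. Qed.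

Lemma mcoeff_monomial k p : (monomial k)@_p = (k == p)%:R.
Proof. by rewrite mcoeffU. Qed.

Section Coefficients.
Implicit Types (f g : laurent) (p : int * int).

(** A named function of the polynomial, so that it can carry the structure of
    an additive map. *)
Definition lcoef p f : rat := f@_p.

Lemma lcoef_is_additive p : zmod_morphism (lcoef p).
Proof. by move=> f g; rewrite /lcoef [LHS]mcoeffB. Qed.

HB.instance Definition _ p :=
  GRing.isZmodMorphism.Build laurent rat (lcoef p) (lcoef_is_additive p).

Lemma lcoef0 p : (0 : laurent)@_p = 0.
Proof. exact: (raddf0 (lcoef p)). Qed.

Lemma lcoefD f g p : (f + g)@_p = f@_p + g@_p.
Proof. exact: (raddfD (lcoef p)). Qed.

Lemma lcoefB f g p : (f - g)@_p = f@_p - g@_p.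
Proof. exact: (raddfB (lcoef p)). Qed.

Lemma lcoefMn f n p : (f *+ n)@_p = f@_p *+ n.
Proof. exact: (raddfMn (lcoef p)). Qed.

Lemma lcoefMz f z p : (f *~ z)@_p = f@_p *~ z.
Proof. exact: (raddfMz (lcoef p)). Qed.

Lemma lcoef_sum (I : Type) (r : seq I) (F : I -> laurent) p :
  (\sum_(i <- r) F i)@_p = \sum_(i <- r) (F i)@_p.
Proof. exact: (raddf_sum (lcoef p)). Qed.

End Coefficients.

Lemma mcoeff_monomialM k (f : laurent) p : (monomial k * f)@_p = f@_(p - k).
Proof.
elim/laurent_ind: f => [|f g IHf IHg|c l].
- by rewrite mulr0 !lcoef0.
- rewrite mulrDr lcoefD [RHS]lcoefD; exact (f_equal2 +%R IHf IHg).
- by rewrite monomial_mulUU mul1r !mcoeffU [l == _]eq_sym subr_eq addrC eq_sym.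
Qed.

(** * Derivations graded by the exponents *)

(** For a linear form ell on exponents this is a logarithmic derivation: the
    first projection gives x d/dx and the second one y d/dy. *)
Definition der (ell : int * int -> int) (f : laurent) : laurent :=
  [malg k in msupp f => (ell k)%:~R * f@_k].

Lemma mcoeff_der ell f k : (der ell f)@_k = (ell k)%:~R * f@_k.
Proof.
rewrite mcoeffE; case: ifP => // /negbT /mcoeff_outdom ->; by rewrite mulr0.
Qed.

Lemma der_is_additive ell : zmod_morphism (der ell).
Proof.
by move=> f g; apply/malgP => k; rewrite !(lcoefB, mcoeff_der) mulrBr.
Qed.

HB.instance Definition _ ell :=
  GRing.isZmodMorphism.Build laurent laurent (der ell) (der_is_additive ell).

Lemma derU ell (c : rat) k :
  der ell << c *g k >> = << (ell k)%:~R * c *g k >>.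
Proof.
apply/malgP => p; rewrite mcoeff_der [RHS]mcoeffU [X in _ * X]mcoeffU.
by case: eqP => [->|]; rewrite ?mulr0.
Qed.

Lemma der_monomial ell k : der ell (monomial k) = monomial k *~ ell k.
Proof.
apply/malgP => p; rewrite mcoeff_der lcoefMz !mcoeff_monomial.
by rewrite mulrzl; case: eqP => [->|]; rewrite ?mul0rz.
Qed.

(** Both sides are additive in f and in g, which leaves the case of two
    monomials, where the rule is the additivity of ell. *)
Lemma derM (ell : {additive (int * int)%type -> int}) (f g : laurent) :
  der ell (f * g) = der ell f * g + f * der ell g.
Proof.
elim/laurent_ind: f => [|f1 f2 IH1 IH2|c k].
- by rewrite raddf0 !mul0r raddf0 addr0.
- rewrite (mulrDl f1 f2 g) (raddfD (der ell) (f1 * g)) (raddfD (der ell) f1 f2).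
  rewrite /= (mulrDl (der ell f1)) (mulrDl f1 f2 (der ell g)) addrACA.
  exact (f_equal2 +%R IH1 IH2).
elim/laurent_ind: g => [|g1 g2 IH1 IH2|d l].
- by rewrite raddf0 !mulr0 raddf0 addr0.
- set h : laurent := << c *g k >>.
  rewrite (mulrDr h g1 g2) (raddfD (der ell) (h * g1)) (raddfD (der ell) g1 g2).
  rewrite /= (mulrDr (der ell h)) (mulrDr h (der ell g1)) addrACA.
  exact (f_equal2 +%R IH1 IH2).
rewrite (monomial_mulUU c d) (derU ell (c * d)) (derU ell c) (derU ell d).
rewrite (monomial_mulUU ((ell k)%:~R * c) d).
rewrite (monomial_mulUU c ((ell l)%:~R * d)) -monalgUD raddfD /= intrD.
by congr << _ *g _ >>; ring.
Qed.

Section Derivation.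
Variables (A : comNzRingType) (D : {additive A -> A}).
Hypothesis leibniz : forall f g, D (f * g) = D f * g + f * D g.

Lemma leibnizX f n : D (f ^+ n.+1) = (f ^+ n * D f) *+ n.+1.
Proof.
elim: n => [|n IH]; first by rewrite expr1 mul1r.
by rewrite exprS leibniz IH mulrnAr mulrA -exprS mulrC [RHS]mulrS.
Qed.

Lemma leibniz_ker a f n : D a = 0 ->
  D (a * f ^+ n.+1) = (a * (f ^+ n * D f)) *+ n.+1.
Proof. by move=> a0; rewrite leibniz a0 mul0r add0r leibnizX mulrnAr. Qed.

End Derivation.

(** The Leibniz rule is an argument of the predicate because the subring
    structure below depends on it and is recovered from the term. *)
Definition der_ker (A : comNzRingType) (D : {additive A -> A})
    of (forall f g, D (f * g) = D f * g + f * D g) : pred A :=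
  fun f => D f == 0.

Section DerivationKernel.
Variables (A : comNzRingType) (D : {additive A -> A}).
Hypothesis leibniz : forall f g, D (f * g) = D f * g + f * D g.

Lemma der_kerP f : reflect (D f = 0) (f \in der_ker leibniz).
Proof. exact: eqP. Qed.

Lemma der_ker_subring : subring_closed (der_ker leibniz).
Proof.
split=> [|f g /der_kerP f0 /der_kerP g0|f g /der_kerP f0 /der_kerP g0];
  apply/der_kerP.
- by have := leibniz 1 1; rewrite !mulr1 mul1r -[LHS]addr0 => /addrI.
- by rewrite raddfB f0 g0 subrr.
- by rewrite leibniz f0 g0 mul0r mulr0 addr0.
Qed.

HB.instance Definition _ :=
  GRing.isSubringClosed.Build A (der_ker leibniz) der_ker_subring.

End DerivationKernel.

(** The polynomial a f^n D(f) is D(a f^(n+1)) / (n+1), and D multiplies the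
    coefficient at p by ell p = 0. *)
Lemma mcoeff_exact (ell : {additive (int * int)%type -> int})
    (a f : laurent) n p :
  der ell a = 0 -> ell p = 0 -> (a * (f ^+ n * der ell f))@_p = 0.
Proof.
move=> a0 p0; have := mcoeff_der ell (a * f ^+ n.+1) p.
rewrite (leibniz_ker (derM ell)) // p0 mul0r lcoefMn => /eqP.
by rewrite mulrn_eq0 /= => /eqP.
Qed.

Lemma hornerMX (A : comNzRingType) (h : {poly A}) (f d : A) n :
  h.[f] * d * f ^+ n = \sum_(i < size h) h`_i * (f ^+ (n + i) * d).
Proof.
by rewrite horner_coef !mulr_suml; apply: eq_bigr => i _; rewrite exprD; ring.
Qed.

Lemma mcoeff_exact_poly (ell : {additive (int * int)%type -> int})
    (h : {poly laurent}) (f : laurent) n p :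
    h \is a polyOver (der_ker (derM ell)) -> ell p = 0 ->
  (h.[f] * der ell f * f ^+ n)@_p = 0.
Proof.
move=> /polyOverP hker p0; rewrite hornerMX lcoef_sum big1 // => i _.
by apply: mcoeff_exact => //; apply/(der_kerP (derM ell)); exact: hker.
Qed.

(** The monomial of exponent k turns the derivative d/dx, say, into the
    logarithmic derivation x d/dx: a coefficient of x^-1 in P f^n becomes one
    of x^0 in x P f^n. *)
Lemma mcoeff_log_exact (ell : {additive (int * int)%type -> int})
    (h : {poly laurent}) (f P : laurent) k n p :
    h \is a polyOver (der_ker (derM ell)) ->
    monomial k * P = h.[f] * der ell f ->
  ell (p + k) = 0 -> (P * f ^+ n)@_p = 0.
Proof.
move=> hker E pk; rewrite -[p](addrK k) -mcoeff_monomialM mulrA E.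
exact: mcoeff_exact_poly.
Qed.

(** * Quadrant walks with small forward steps *)

Definition step_sum (S : {fset int * int}) : laurent :=
  \sum_(s <- S) monomial s.

Lemma mcoeff_step_sumM S f p :
  (step_sum S * f)@_p = \sum_(s <- S) f@_(p - s).
Proof.
rewrite mulr_suml lcoef_sum; apply: eq_bigr => s _; exact: mcoeff_monomialM.
Qed.

Section Walks.
Variable S : {fset int * int}.
Implicit Types (n : nat) (p : int * int).

Lemma walk_pos_rcons n (w : n.-tuple S) s k :
  walk_pos (rcons_tuple w s) k =
    if (k <= n)%N then walk_pos w k else walk_end w + val s.
Proof.
rewrite /walk_end /walk_pos /= -cats1 take_cat size_tuple.
case: ltngtP => [//|lt_nk|->].
  rewrite take_oversize /= ?subn_gt0 // big_cat big_seq1 /=.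
  by rewrite take_oversize // size_tuple.
by rewrite subnn /= cats0 take_oversize // size_tuple.
Qed.

Lemma walk_end_rcons n (w : n.-tuple S) s :
  walk_end (rcons_tuple w s) = walk_end w + val s.
Proof. by rewrite /walk_end walk_pos_rcons ltnn. Qed.

Lemma quadrant_walk_rcons n (w : n.-tuple S) s :
  quadrant_walk (rcons_tuple w s)
  = quadrant_walk w && in_quadrant (walk_end w + val s).
Proof.
apply/forallP/andP => [qw|[/forallP qw qs] k]; last first.
  rewrite walk_pos_rcons; case: leqP => // le_kn.
  exact: (qw (Ordinal (le_kn : (k < n.+1)%N))).
split; last by have := qw ord_max; rewrite walk_pos_rcons ltnn.
apply/forallP => k; have := qw (widen_ord (leqnSn _) k).
by rewrite walk_pos_rcons /= -ltnS ltn_ord.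
Qed.

Lemma walk_count0 p : walk_count S p 0 = (p == 0).
Proof.
have end0 (w : 0.-tuple S) k : walk_pos w k = 0.
  by rewrite /walk_pos (tuple0 w) big_nil.
rewrite /walk_count -sum1dep_card.
rewrite (eq_bigl (fun w => (w == [tuple]) && (p == 0))) => [|w].
  case: (p =P 0) => _; last by rewrite big_pred0 // => w; rewrite andbF.
  by rewrite (eq_bigl (pred1 [tuple])) ?big_pred1_eq // => w; rewrite andbT.
rewrite [w == _](introT eqP (tuple0 w)) /walk_end end0 [p == 0]eq_sym.
rewrite andb_idl // => _.
by apply/forallP => k; rewrite end0.
Qed.

(** Removing the last step s of a quadrant walk that ends at p leaves a quadrant
    walk that ends at p - s; conversely a step to p in the quadrant extends
    every such walk. *)
Lemma walk_countS p n : in_quadrant p ->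
  walk_count S p n.+1 = (\sum_(s <- S) walk_count S (p - s)%R n)%N.
Proof.
move=> qp; rewrite big_seq_fsetE /= /walk_count -sum1dep_card.
pose ext (sw : S * n.-tuple S) := rcons_tuple sw.2 sw.1.
have ext_bij : bijective ext.
  apply: inj_card_bij; last by rewrite card_prod !card_tuple expnS.
  by move=> [s w] [r v] /(congr1 val) /= /rcons_inj[/val_inj -> ->].
rewrite (reindex ext) /=; last exact: onW_bij.
rewrite [RHS](eq_bigr (fun s => \sum_(w : n.-tuple S |
    quadrant_walk w && (walk_end w == (p - val s)%R)) 1)%N); last first.
  by move=> s _; rewrite sum1dep_card.
rewrite pair_big_dep; apply: eq_bigl => -[s w] /=.
rewrite quadrant_walk_rcons walk_end_rcons [X in _ = _ && X]eq_sym subr_eq.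
rewrite [p == _]eq_sym -andbA; congr (_ && _).
by case: (_ =P p) => [->|_]; rewrite ?andbF ?qp.
Qed.

End Walks.

Lemma geometric_series (P a : laurent) :
  fpsC P / (1 - sT * fpsC a) = Fps (fun n => P * a ^+ n).
Proof.
apply: (mulIr (geometric_unit a)); rewrite divrK ?geometric_unit //.
have -> : Fps (fun n => P * a ^+ n) = fpsC P * Fps (fun n => a ^+ n).
  apply/fpsP => n; rewrite fcoefM big_ord_recl /= subn0.
  by rewrite big1 ?addr0 // => i _; rewrite mul0r.
by rewrite -mulrA [_ * (1 - _)]mulrC fps_geometric mulr1.
Qed.

(** For steps with coordinates at most 1, unconstrained walks weighted by P count
    quadrant walks as soon as their contributions cancel on the lines just
    outside the quadrant: the recurrences of the two counts differ by terms
    p - s outside the quadrant, and these lie on one of the two lines. *)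
Lemma quadrant_series_nonneg_part (S : {fset int * int}) (P : laurent) :
    (forall s, s \in S -> s.1 <= 1 /\ s.2 <= 1) ->
    (forall p, in_quadrant p -> P@_p = (p == 0)%:R) ->
    (forall n p, p.1 = -1 \/ p.2 = -1 -> (P * step_sum S ^+ n)@_p = 0) ->
  quadrant_series S = nonneg_part (fpsC P / (1 - sT * fpsC (step_sum S))).
Proof.
move=> small P0 bound; rewrite geometric_series; apply/fpsP => n; apply/malgP.
move=> p; rewrite quadrant_seriesE nonneg_partE /=.
elim: n p => [|n IH] p; case: ifP => [qp|/negbT /walk_count_out -> //].
  by rewrite walk_count0 mulr1 P0.
rewrite walk_countS // exprS mulrCA mcoeff_step_sumM natr_sum.
rewrite big_seq [RHS]big_seq; apply: eq_bigr => s /small[s1 s2].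
rewrite IH; case: ifP => // /negbT nq; rewrite bound //.
have step_out (a b c d : int) : c <= 1 -> d <= 1 -> 0 <= a -> 0 <= b ->
    ~~ ((0 <= a - c) && (0 <= b - d)) -> a - c = -1 \/ b - d = -1 by lia.
by case/andP: qp => p1 p2; apply: step_out.
Qed.


(** * The weight of the starting points *)

Definition numerator (A : comNzRingType) (x y : A) : A :=
  (x ^+ 2 + 1) * (x + y) * (y - x) * (x ^+ 2 * y - 2 * x - y)
    * (x ^+ 3 - x - 2 * y).

(** The triples (a, b, c) stand for the terms c x^a y^b.  Each one has a < 7 or
    b < 3, so that division by x^7 y^3 sends it out of the quadrant; this is
    what makes the quadrant part of the weight equal to 1. *)
Definition minor_terms : seq (nat * nat * int) :=
  [:: (9, 1, (-1)%Z); (8, 0, 2%Z); (7, 1, 1%Z); (5, 1, (-3)%Z);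
      (5, 3, (-1)%Z); (4, 0, (-2)%Z); (4, 4, (-2)%Z); (3, 3, 3%Z);
      (3, 1, (-5)%Z); (1, 3, 5%Z); (0, 4, 2%Z)]%N.

Lemma numeratorE (A : comNzRingType) (x y : A) :
  numerator x y = x ^+ 7 * y ^+ 3
    + \sum_(c <- minor_terms) (x ^+ c.1.1 * y ^+ c.1.2) *~ c.2.
Proof. rewrite !big_cons big_nil /numerator /=; ring. Qed.

(** The identities hold over any commutative ring in which x' and y' are inverse
    to x and y.  They are proved by clearing denominators, so that every x' and
    y' occurs in a product x x' or y y' and what remains is polynomial. *)
Section Weight.
Variables (A : comNzRingType) (x x' y y' : A).
Hypotheses (xx' : x * x' = 1) (yy' : y * y' = 1).
Let S : A := x + x' + x' ^+ 2 * y + y'.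
Let P : A := x' ^+ 7 * y' ^+ 3 * numerator x y.

Lemma cancel_units m n f g :
  x ^+ m * y ^+ n * f = x ^+ m * y ^+ n * g -> f = g.
Proof.
move=> /(congr1 ( *%R (x' ^+ m * y' ^+ n))).
have E h : x' ^+ m * y' ^+ n * (x ^+ m * y ^+ n * h)
           = (x * x') ^+ m * (y * y') ^+ n * h by rewrite !exprMn; ring.
by rewrite !E xx' yy' !expr1n !mul1r.
Qed.

Let PE : x ^+ 7 * y ^+ 3 * P = numerator x y.
Proof.
rewrite (_ : _ * P = (x * x') ^+ 7 * (y * y') ^+ 3 * numerator x y).
  by rewrite xx' yy' !expr1n !mul1r.
by rewrite /P; ring.
Qed.

Let SE : x ^+ 2 * y * S = x ^+ 3 * y + x * y + y ^+ 2 + x ^+ 2.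
Proof.
rewrite (_ : _ * S = x ^+ 3 * y + x * y * (x * x') + y ^+ 2 * (x * x') ^+ 2
                     + x ^+ 2 * (y * y')); first by rewrite xx' yy'; ring.
by rewrite /S; ring.
Qed.

Lemma weightE : P = 1 +
  \sum_(c <- minor_terms)
     (x' ^+ 7 * x ^+ c.1.1 * (y' ^+ 3 * y ^+ c.1.2)) *~ c.2.
Proof.
rewrite /P numeratorE mulrDr; congr (_ + _).
  by rewrite mulrACA -!exprMn (mulrC x') (mulrC y') xx' yy' !expr1n mulr1.
rewrite mulr_sumr; apply: eq_bigr => c _.
by rewrite mulrzAr mulrACA.
Qed.

Variable D : {additive A -> A}.
Hypothesis leibniz : forall f g, D (f * g) = D f * g + f * D g.

(** The coefficients of h are those of (-y u^2 + 2 u + 2 y + y^3) / y^3 expanded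
    in powers of S, where u = S - 1/y. *)
Lemma exact_x : D x = x -> D x' = - x' -> D y = 0 -> D y' = 0 ->
  exists2 h, h \is a polyOver (der_ker leibniz) & x * P = h.[S] * D S.
Proof.
move=> Dx Dx' Dy Dy'.
exists (- (y' ^+ 2)%:P * 'X ^+ 2 + (4 * y' ^+ 3)%:P * 'X
        + (1 + 2 * y' ^+ 2 - 3 * y' ^+ 4)%:P).
  have y'K : y' \in der_ker leibniz by apply/der_kerP.
  by rewrite !(rpredD, rpredN, rpredM, rpredX, polyOverC, polyOverX, rpred_nat,
               rpred1, rpredB).
have -> : D S = x - x' - 2 * x' ^+ 2 * y.
  by rewrite /S expr2 !raddfD /= !leibniz Dx Dx' Dy Dy'; ring.
set h := _ + _%:P.
have -> : h.[S] = - y' ^+ 2 * S ^+ 2 + 4 * y' ^+ 3 * S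
                  + (1 + 2 * y' ^+ 2 - 3 * y' ^+ 4).
  by rewrite /h !hornerE; ring.
apply: (@cancel_units 6 4).
have DE : x ^+ 2 * (x - x' - 2 * x' ^+ 2 * y) = x ^+ 3 - x - 2 * y.
  rewrite (_ : _ * _ = x ^+ 3 - x * (x * x') - 2 * y * (x * x') ^+ 2).
    by rewrite xx'; ring.
  by ring.
transitivity (y * (x ^+ 7 * y ^+ 3 * P)); first by ring.
rewrite PE.
transitivity ((- (y * y') ^+ 2 * (x ^+ 2 * y * S) ^+ 2
     + 4 * (y * y') ^+ 3 * x ^+ 2 * (x ^+ 2 * y * S)
     + x ^+ 4 * (y ^+ 4 + 2 * y ^+ 2 * (y * y') ^+ 2 - 3 * (y * y') ^+ 4))
   * (x ^+ 2 * (x - x' - 2 * x' ^+ 2 * y))); last by ring.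
by rewrite SE DE yy' /numerator; ring.
Qed.

(** The symmetry y -> x^2 / y of S sends each of x^2 y - 2 x - y and
    x^3 - x - 2 y to x / y times the other one.  Their product divided by y is
    thus invariant, hence a polynomial in v = S - x - 1/x over the Laurent
    polynomials in x; it has degree 1. *)
Lemma exact_y : D x = 0 -> D x' = 0 -> D y = y -> D y' = - y' ->
  exists2 h, h \is a polyOver (der_ker leibniz) & y * P = h.[S] * D S.
Proof.
move=> Dx Dx' Dy Dy'.
exists ((x' ^+ 4 * (x ^+ 2 + 1) * (3 * x ^+ 4 - 2 * x ^+ 2 + 3))%:P
        - (2 * x' ^+ 3 * (x ^+ 4 - 1))%:P * 'X).
  have xK : x \in der_ker leibniz by apply/der_kerP.
  have x'K : x' \in der_ker leibniz by apply/der_kerP.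
  by rewrite !(rpredD, rpredN, rpredM, rpredX, polyOverC, polyOverX, rpred_nat,
               rpred1, rpredB).
have -> : D S = x' ^+ 2 * y - y'.
  by rewrite /S expr2 !raddfD /= !leibniz Dx Dx' Dy Dy'; ring.
set h := _ - _ * 'X.
have -> : h.[S] = x' ^+ 4 * (x ^+ 2 + 1) * (3 * x ^+ 4 - 2 * x ^+ 2 + 3)
                  - 2 * x' ^+ 3 * (x ^+ 4 - 1) * S.
  by rewrite /h !hornerE; ring.
apply: (@cancel_units 7 2).
have DE : x ^+ 2 * y * (x' ^+ 2 * y - y') = y ^+ 2 - x ^+ 2.
  rewrite (_ : _ * _ = (x * x') ^+ 2 * y ^+ 2 - (y * y') * x ^+ 2).
    by rewrite xx' yy'; ring.
  by ring.
transitivity (x ^+ 7 * y ^+ 3 * P); first by ring.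
rewrite PE.
transitivity ((x * y * (x * x') ^+ 4 * (x ^+ 2 + 1)
       * (3 * x ^+ 4 - 2 * x ^+ 2 + 3)
     - 2 * (x * x') ^+ 3 * (x ^+ 4 - 1) * (x ^+ 2 * y * S))
   * (x ^+ 2 * y * (x' ^+ 2 * y - y'))); last by ring.
by rewrite SE DE xx' /numerator; ring.
Qed.

End Weight.

(** * Specialization to Laurent polynomials *)

Definition lX : laurent := monomial (1, 0).
Definition lXV : laurent := monomial (-1, 0).
Definition lY : laurent := monomial (0, 1).
Definition lYV : laurent := monomial (0, -1).

Definition weight : laurent := lXV ^+ 7 * lYV ^+ 3 * numerator lX lY.

Lemma lXXV : lX * lXV = 1. Proof. by rewrite -[LHS]monomialD. Qed.
Lemma lYYV : lY * lYV = 1. Proof. by rewrite -[LHS]monomialD. Qed.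

Lemma steps_perm :
  perm_eq steps ([:: (1, 0); (-1, 0); (-2, 1); (0, -1)] : seq (int * int)).
Proof.
apply: uniq_perm => [||s]; [exact: fset_uniq | by [] |].
by rewrite /steps !in_fsetE !inE -!orbA [(s == (0, -1)) || _]orbC.
Qed.

Lemma step_sumE : step_sum steps = lX + lXV + lXV ^+ 2 * lY + lYV.
Proof.
have -> : lXV ^+ 2 * lY = monomial (-2, 1) by rewrite expr2 -!monomialD.
rewrite /step_sum (perm_big _ steps_perm) /=.
have sum4 (I : Type) (V : nmodType) (F : I -> V) a b c d :
    \sum_(i <- [:: a; b; c; d]) F i = F a + F b + F c + F d.
  by rewrite !big_cons big_nil addr0 !addrA.
exact (sum4 _ _ monomial (1, 0) (-1, 0) (-2, 1) (0, -1)).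
Qed.

Lemma exp_morph_prod (V : zmodType) (A : comNzRingType) (e : V -> A) :
    e 0 = 1 -> (forall k l, e (k + l) = e k * e l) ->
  forall k1 k2 k3 k4 n1 n2 n3 n4,
    e k1 ^+ n1 * e k2 ^+ n2 * (e k3 ^+ n3 * e k4 ^+ n4)
    = e (k1 *+ n1 + k2 *+ n2 + (k3 *+ n3 + k4 *+ n4)).
Proof.
move=> e0 eD; have eX k n : e (k *+ n) = e k ^+ n.
  by elim: n => [|n IH]; rewrite ?mulr0n // mulrS eD IH exprS.
by move=> *; rewrite !eD !eX.
Qed.

Lemma shifted_monomial (a b : nat) :
  lXV ^+ 7 * lX ^+ a * (lYV ^+ 3 * lY ^+ b) = monomial (a%:Z - 7, b%:Z - 3).
Proof.
have pairMn (u v : int) n : (u, v) *+ n = (u *+ n, v *+ n).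
  by elim: n => // n IH; rewrite !mulrS IH.
transitivity (monomial
  ((-1, 0) *+ 7 + (1, 0) *+ a + ((0, -1) *+ 3 + (0, 1) *+ b))).
  exact (exp_morph_prod (erefl 1) monomialD _ _ _ _ 7 a 3 b).
rewrite !pairMn !mul0rn !natz; congr monomial.
apply: injective_projections => /=; lia.
Qed.

Lemma mcoeff_weight_quadrant p : in_quadrant p -> weight@_p = (p == 0)%:R.
Proof.
move=> qp; rewrite [weight](weightE lXXV lYYV) lcoefD lcoef_sum.
rewrite mcoeff_monomial eq_sym big_seq big1 ?addr0 // => c.
have out : all (fun c => (c.1.1 < 7) || (c.1.2 < 3))%N minor_terms by [].
move=> /(allP out) {}out.
rewrite lcoefMz shifted_monomial mcoeff_monomial.
case: eqP => [pE|_]; last by rewrite mul0rz.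
have p1 := congr1 fst pE; have p2 := congr1 snd pE.
exfalso; move: qp out; rewrite /in_quadrant -p1 -p2 /=; lia.
Qed.

Lemma mcoeff_weight_boundary n p :
  p.1 = -1 \/ p.2 = -1 -> (weight * step_sum steps ^+ n)@_p = 0.
Proof.
rewrite step_sumE => -[p1|p2].
- have [||||h hker E] := @exact_x _ _ _ _ _ lXXV lYYV _ (derM fst);
    try by rewrite [LHS]der_monomial.
  by apply: (mcoeff_log_exact n hker E); rewrite /= p1.
- have [||||h hker E] := @exact_y _ _ _ _ _ lXXV lYYV _ (derM snd);
    try by rewrite [LHS]der_monomial.
  by apply: (mcoeff_log_exact n hker E); rewrite /= p2.
Qed.

Lemma fpsC_is_additive : zmod_morphism (@fpsC laurent).
Proof. by move=> f g; apply/fpsP => -[|n] //=; rewrite subr0. Qed.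

Lemma fpsC_is_multiplicative : monoid_morphism (@fpsC laurent).
Proof. by split=> // f g; rewrite fpsCM. Qed.

HB.instance Definition _ :=
  GRing.isZmodMorphism.Build laurent (fps laurent) (@fpsC laurent)
    fpsC_is_additive.
HB.instance Definition _ :=
  GRing.isMonoidMorphism.Build laurent (fps laurent) (@fpsC laurent)
    fpsC_is_multiplicative.

Lemma rmorph_weight (A B : comNzRingType) (f : {rmorphism A -> B}) u u' v v' :
  f (u' ^+ 7 * v' ^+ 3 * numerator u v)
  = f u' ^+ 7 * f v' ^+ 3 * numerator (f u) (f v).
Proof.
by rewrite /numerator !(rmorphM, rmorphXn, rmorphD, rmorphN, rmorph1,
                        rmorph_nat).
Qed.

Lemma rmorph_steps (A B : comNzRingType) (f : {rmorphism A -> B}) u u' v v' :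
  f (u + u' + u' ^+ 2 * v + v') = f u + f u' + f u' ^+ 2 * f v + f v'.
Proof. by rewrite !rmorphD rmorphM rmorphXn. Qed.

Lemma divr_monomial (A : comUnitRingType) (f F g h t w w' : A) m n :
    g \is a GRing.unit -> h \is a GRing.unit -> 1 - t * w \is a GRing.unit ->
    w = w' -> F = g^-1 ^+ m * h^-1 ^+ n * f ->
  F / (1 - t * w) = f / (g ^+ m * h ^+ n * (1 - t * w')).
Proof.
move=> gU hU wU <- ->.
rewrite !invrM ?unitrMl ?unitrX // -!exprVn; ring.
Qed.

Lemma steps_small s : s \in steps -> s.1 <= 1 /\ s.2 <= 1.
Proof. by rewrite (perm_mem steps_perm) !inE => /or4P[] /eqP ->. Qed.

Theorem proposition16 :
  let x := sX in
  let y := sY in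
  let t := sT in
  quadrant_series steps
  = nonneg_part
      (((x ^+ 2 + 1) * (x + y) * (y - x) * (x ^+ 2 * y - 2 * x - y)
          * (x ^+ 3 - x - 2 * y))
       / (x ^+ 7 * y ^+ 3 * (1 - t * (x + x^-1 + x ^- 2 * y + y^-1)))).
Proof.
move=> x y t.
have stepsE : fpsC (step_sum steps) = x + x^-1 + x ^- 2 * y + y^-1.
  rewrite step_sumE -[x ^- 2]exprVn /x /y sXV sYV.
  exact (rmorph_steps _ lX lXV lY lYV).
have weightE : fpsC weight = x^-1 ^+ 7 * y^-1 ^+ 3 * numerator x y.
  rewrite /x /y sXV sYV; exact (rmorph_weight _ lX lXV lY lYV).
transitivity (nonneg_part (fpsC weight / (1 - t * fpsC (step_sum steps)))).
  exact (quadrant_series_nonneg_part steps_small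
           mcoeff_weight_quadrant mcoeff_weight_boundary).
exact (f_equal nonneg_part
  (divr_monomial sX_unit sY_unit (geometric_unit _) stepsE weightE)).
Qed.
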